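(* Let $(X,d)$ be a metric space and let $E\ge 1$ be an integer. Fix one kind of balls (either all open or all closed). The following are equivalent: 1) $(X,d)$ has the equal radius Besicovitch intersection property with constant $E$, i.e. $E(X,d)\le E$. 2) For every $r>0$ and every $\tau$-additive, locally finite Borel measure $\mu$ on $X$, we have $\|A_{r,\mu}\|_{L^1\to L^1}\le E$. 3) For every $r>0$ and every finite weighted sum of Dirac deltas $\mu:=\sum_{i=1}^N c_i\delta_{x_i}$ (with $N\ge 1$, $x_i\in X$, $c_i>0$), the averaging operator satisfies $\|A_{r,\mu}\|_{L^1\to L^1}\le E$.
   Context: Metric spaces are assumed to have at least two points; all measures are assumed to be not identically zero. Balls: $B^{o}(x,r)=\{y\in X: d(x,y)<r\}$ (open) and $B^{cl}(x,r)=\{y\in X: d(x,y)\le r\}$ (closed), $r>0$. The notation $B(x,r)$ means that all balls are of the same kind, i.e. all open or all closed (the same choice in every definition below). A ball is understood to come with a chosen center and radius. Measures: a Borel measure $\mu$ on $X$ is $\tau$-additive if for every collection $\{O_\alpha:\alpha\in\Lambda\}$ of open sets, $\mu(\bigcup_\alpha O_\alpha)=\sup \mu(\bigcup_{i=1}^n O_{\alpha_i})$, the supremum being over all finite subcollections $\{O_{\alpha_1},\dots,O_{\alpha_n}\}$. It is locally finite if it assigns finite measure to bounded Borel sets. The support of $\mu$ is the complement of $\bigcup\{B^{o}(x,r): x\in X,\ r>0,\ \mu B^{o}(x,r)=0\}$; for $\tau$-additive, locally finite $\mu$ the complement of the support has measure zero. Averaging operators: for $r>0$, $g$ locally integrable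 and $x\in\operatorname{supp}\mu$, $A_{r,\mu}g(x):=\frac{1}{\mu(B(x,r))}\int_{B(x,r)}g\,d\mu$ (so $A_{r,\mu}g$ is defined $\mu$-a.e.). $\|A_{r,\mu}\|_{L^1\to L^1}$ is the smallest $c$ with $\|A_{r,\mu}g\|_{L^1(\mu)}\le c\|g\|_{L^1(\mu)}$ for all $g\in L^1(\mu)$ (and $\infty$ if there is none). Equal radius Besicovitch constant: a collection $\mathcal{C}$ of balls in $(X,d)$ is a Besicovitch family if for every pair of distinct balls $B(x,r),B(y,s)\in\mathcal{C}$, $x\notin B(y,s)$ and $y\notin B(x,r)$. Let $\mathcal{EBF}(X,d)$ be the collection of all Besicovitch families of $(X,d)$ all of whose balls have equal radius. Then $E(X,d):=\sup\{\sum_{B(x,r)\in\mathcal{C}}\mathbf{1}_{B(x,r)}(y): y\in X,\ \mathcal{C}\in\mathcal{EBF}(X,d)\}$. The equal radius Besicovitch intersection property means $E(X,d)<\infty$. *)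

(* Defs.v *)
From HB Require Import structures.
From mathcomp Require Import all_boot all_order all_algebra.
From mathcomp Require Import all_classical all_reals all_analysis.

Set Implicit Arguments.
Unset Strict Implicit.
Unset Printing Implicit Defensive.

Import Order.TTheory GRing.Theory Num.Theory.
Import numFieldNormedType.Exports.

Local Open Scope classical_set_scope.
Local Open Scope ring_scope.

(* The library's measurable types are pointed, hence so are our metric spaces;
   for nonempty spaces this is no restriction. *)
#[short(type="pmetricType")]
HB.structure Definition PointedMetric (K : numDomainType) :=
  { M of Metric K M & isPointed M }.

Variant ball_kind := OpenBalls | ClosedBalls.

Notation borel X := (g_sigma_algebraType (@open X)).

Section metric_balls.
Context {R : realType} {X : pmetricType R}.

(* The library's [closed_ball] is the closure of the open ball, which is in
   general smaller than the closed ball used here. *)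
Definition mball (k : ball_kind) (x : X) (r : R) : set X :=
  match k with
  | OpenBalls => [set y | mdist x y < r]
  | ClosedBalls => [set y | mdist x y <= r]
  end.

(* A ball carries its center and radius, so a collection of balls is a set of
   pairs (center, radius). *)
Definition besicovitch_family (k : ball_kind) (C : set (X * R)) : Prop :=
  (forall b, C b -> 0 < b.2) /\
  (forall b b', C b -> C b' -> b <> b' ->
    ~ mball k b'.1 b'.2 b.1 /\ ~ mball k b.1 b.2 b'.1).

Definition EBF (k : ball_kind) : set (set (X * R)) :=
  [set C | besicovitch_family k C /\
           forall b b', C b -> C b' -> b.2 = b'.2].

Definition metric_bounded (A : set X) : Prop :=
  exists M : R, forall x y, A x -> A y -> mdist x y <= M.

End metric_balls.

Definition besicovitch_constant {R : realType} (X : pmetricType R)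
    (k : ball_kind) : \bar R :=
  ereal_sup [set \esum_(b in C) (\1_(mball k b.1 b.2) y)%:E
            | C in @EBF R X k & y in [set: X]].

Section borel_measures.
Context {R : realType} {X : pmetricType R}.
Variable mu : {measure set (borel X) -> \bar R}.
Local Open Scope ereal_scope.

Definition tau_additive : Prop :=
  forall G : set (set X), G `<=` open ->
    mu (\bigcup_(O in G) O) =
    ereal_sup [set mu (\bigcup_(O in F) O)
              | F in [set F : set (set X) | finite_set F /\ F `<=` G]].

Definition locally_finite : Prop :=
  forall A : set (borel X), measurable A -> metric_bounded A -> mu A < +oo.

Definition msupport : set X :=
  ~` (\bigcup_(b in [set b : X * R |
                      (0 < b.2)%R /\ mu (mball OpenBalls b.1 b.2) = 0])
        mball OpenBalls b.1 b.2).

(* The value 0 outside the support is a junk value on a mu-null set. *)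
Definition averaging (k : ball_kind) (r : R) (g : X -> R) (x : X) : R :=
  if x \in msupport then
    ((fine (mu (mball k x r)))^-1 * Rintegral mu (mball k x r) g)%R
  else 0%R.

Definition averaging_L1_norm (k : ball_kind) (r : R) : \bar R :=
  ereal_inf [set c%:E | c in [set c : R | (0 <= c)%R /\
    forall g : borel X -> R, mu.-integrable [set: borel X] (EFin \o g) ->
      'N[mu]_1 [EFin \o averaging k r g] <= c%:E * 'N[mu]_1 [EFin \o g]]].

End borel_measures.

(* The measure \sum_(i < N) c i * dirac (x i); only the first N terms of the
   sequences x and c matter. *)
Definition weighted_dirac_sum {R : realType} {X : pmetricType R} (N : nat)
    (x : nat -> X) (c : nat -> {posnum R}) : {measure set (borel X) -> \bar R} :=
  msum (fun i => mscale (c i)%:num%:nng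
                   (dirac (x i : borel X) : {measure set (borel X) -> \bar R}))
       N.

(* Main.v *)
(** 1 => 2: for the kernel [1_{d(x,y)<r} / mu(B(x,r))], Tonelli's theorem reduces
    the bound to [\int_{B(y,r)} dmu(x) / mu(B(x,r)) <= E] for each [y]. Bounding
    the integrand from below by simple functions [h], pick [x1] maximizing [h],
    note that [\int_{B(x1,r)} h dmu <= h(x1) mu(B(x1,r)) <= 1], remove B(x1,r)
    and iterate: the chosen centers form a Besicovitch family of balls
    containing [y], so the process stops after at most [E] steps.
    Tonelli requires [{d(x,y)<r}] to be product measurable, which may fail on a
    nonseparable space; tau-additivity provides a conull separable set on which
    it holds.
    3 => 1: if [n > E] separated points lie in B(y,r), then the indicator of [y]
    under [n^-1 delta_y + \sum_i delta_{x_i}] forces the norm to be at least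
    [n^2/(n+1) > E]. *)
Require Import Defs.
From HB Require Import structures.
From mathcomp Require Import all_boot all_order all_algebra.
From mathcomp Require Import all_classical all_reals all_analysis.
From mathcomp Require Import measurable_realfun lra zify.
Import Order.TTheory GRing.Theory Num.Theory.
Local Open Scope classical_set_scope.
Local Open Scope ring_scope.

Set Implicit Arguments.
Unset Strict Implicit.
Unset Printing Implicit Defensive.

(** * Balls of either kind: symmetry, Borel measurability, boundedness *)

Lemma mball_sym (R : realType) (X : pmetricType R) (k : ball_kind) (x y : X)
  (r : R) : mball k x r y -> mball k y r x.
Proof. by case: k => /=; rewrite metric_sym. Qed.

Lemma mball_center (R : realType) (X : pmetricType R) (k : ball_kind) (x : X)
  (r : R) : 0 < r -> mball k x r x.
Proof. by case: k => /= r0; rewrite mdistxx// ltW. Qed.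

Lemma mball_nbhs (R : realType) (X : pmetricType R) (x : X) (e : R) :
  0 < e -> nbhs x (mball OpenBalls x e).
Proof. by move=> e0; have := (@nbhsx_ballx _ _ x _ e0); rewrite ballEmdist. Qed.

Lemma open_mball (R : realType) (X : pmetricType R) (x : X) (r : R) :
  open (mball OpenBalls x r).
Proof.
rewrite openE => y /= xy; rewrite /interior.
have ry : 0 < r - mdist x y by rewrite subr_gt0.
apply: filterS (mball_nbhs y ry) => z /= yz.
by rewrite (le_lt_trans (metric_triangle x y z))// -ltrBrDl.
Qed.

Lemma closed_mball (R : realType) (X : pmetricType R) (x : X) (r : R) :
  closed (mball ClosedBalls x r).
Proof.
rewrite -openC openE => y /= /negP; rewrite -ltNge => xy; rewrite /interior.
have ry : 0 < mdist x y - r by rewrite subr_gt0.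
apply: filterS (mball_nbhs y ry) => z /= yz; apply/negP; rewrite -ltNge.
have := metric_triangle x z y; rewrite (metric_sym z y) => h.
move: yz; rewrite ltrBrDr => yz.
by rewrite -(ltrD2l (mdist y z)) (lt_le_trans yz)// addrC.
Qed.

Lemma measurable_open (R : realType) (X : pmetricType R) (A : set X) :
  open A -> measurable (A : set (borel X)).
Proof. by move=> oA; apply: sub_sigma_algebra. Qed.

Lemma measurable_mball (R : realType) (X : pmetricType R) (k : ball_kind)
  (x : X) (r : R) : measurable (mball k x r : set (borel X)).
Proof.
case: k; first by apply: measurable_open; exact: open_mball.
rewrite -[X in measurable X]setCK; apply: measurableC.
apply: (@measurable_open _ X).
by rewrite openC; exact: closed_mball.
Qed.

Lemma measurable_point (R : realType) (X : pmetricType R) (x : X) :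
  measurable ([set x] : set (borel X)).
Proof.
suff -> : [set x] = mball ClosedBalls x 0 by exact: measurable_mball.
apply/seteqP; split => y /=; first by move=> ->; rewrite mdistxx.
move=> xy; apply/esym/mdist_positivity.
by apply/eqP; rewrite eq_le xy mdist_ge0.
Qed.

Lemma mball_bounded (R : realType) (X : pmetricType R) (k : ball_kind) (x : X)
  (r : R) : metric_bounded (mball k x r).
Proof.
exists (r + r) => y z xy xz.
rewrite (le_trans (metric_triangle y x z))// lerD//.
  by move: xy; rewrite metric_sym; case: k {xz} => //= /ltW.
by move: xz; case: k {xy} => //= /ltW.
Qed.

(** * The Besicovitch constant through separated sequences *)

(** Only later entries must avoid the sets of earlier ones, which suits greedy selection; for balls
    of one fixed radius, symmetry makes the order irrelevant. *)
Definition separated_seq {T : choiceType} (B : T -> set T) (s : seq T) : bool :=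
  pairwise (fun x z => z \notin B x) s.

(** With a common radius a family is determined by its centers, and by symmetry of the distance the
    balls containing [y] are those centered in the ball around [y]. *)
Lemma besicovitch_constantP (R : realType) (X : pmetricType R) (k : ball_kind)
  (E : nat) :
  (besicovitch_constant X k <= E%:R%:E)%E <->
  forall (r : R) (y : X) (s : seq X), 0 < r ->
    all (fun x => x \in mball k y r) s -> separated_seq (mball k ^~ r) s ->
    (size s <= E)%N.
Proof.
have sep_uniq (r : R) (s : seq X) :
    0 < r -> separated_seq (mball k ^~ r) s -> uniq s.
  move=> r0; rewrite /separated_seq uniq_pairwise; apply: sub_pairwise => x z.
  by apply: contraNneq => ->; rewrite inE; exact: mball_center.
split=> [CE r y s r0 /allP sy ss|H].
  have us := sep_uniq _ _ r0 ss.
  pose C : set (X * R) := [set` [seq (x, r) | x <- s]].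
  have finC : finite_set C by apply/finite_seqP; eexists.
  have EC : EBF k C.
    split; last by move=> b b' /mapP[? _ ->] /mapP[? _ ->].
    split=> [_ /mapP[? _ ->]//|_ _ /mapP[x xs ->] /mapP[z zs ->] xz].
    have {}xz : x != z by apply: contra_not_neq xz => ->.
    have [] : ~ mball k x r z /\ ~ mball k z r x; last by [].
    (* Admitting [x == z] makes the relation reflexive, so its ordered form passes to all pairs of
       entries. *)
    have /allrelP : all2rel (fun x z => (x == z) || (z \notin mball k x r)) s.
      rewrite -pairwise_all2rel.
      - by apply: sub_pairwise ss => u v /= ->; rewrite orbT.
      - by move=> u; rewrite eqxx.
      - move=> u v; rewrite eq_sym; congr (_ || ~~ _).
        by apply/idP/idP; rewrite !inE; exact: mball_sym.
    move=> sep; have := sep _ _ xs zs; have := sep _ _ zs xs.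
    rewrite (negbTE xz) eq_sym (negbTE xz)/= => zx {}xz.
    by split; [move: xz|move: zx]; rewrite notin_setE.
  rewrite -(ler_nat R) -lee_fin; apply: le_trans CE; apply: ereal_sup_ubound.
  exists C => //; exists y => //.
  rewrite esum_fset//.
  rewrite fsumEFin// -fsbig_seq; last by rewrite map_inj_uniq// => ? ? [].
  rewrite big_map/= (eq_big_seq (fun=> 1)).
    by rewrite big_const_seq count_predT iter_addr_0.
  move=> x /sy; rewrite indicE !inE => /mball_sym yx.
  by rewrite mem_set.
apply: ge_ereal_sup => _ [C [[C0 Csep] Cr]] [y _ <-].
(* [esum] is a supremum over finite subfamilies, so it is enough to bound each finite [F]. *)
apply: ge_ereal_sup => _ [F [finF FC] <-].
have [e ue eF] : exists2 e : seq (X * R), uniq e & F = [set` e].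
  have /finite_seqP[e ->] := finF; exists (undup e); first exact: undup_uniq.
  by apply/seteqP; split => b /=; rewrite mem_undup.
rewrite fsumEFin// {1}eF -fsbig_seq// lee_fin.
pose s := [seq b <- e | y \in mball k b.1 b.2].
have sF b : b \in s -> C b.
  by rewrite mem_filter => /andP[_ be]; apply: FC; rewrite eF.
have -> : \sum_(b <- e) \1_(mball k b.1 b.2) y = (size s)%:R :> R.
  rewrite size_filter -sum1_count natr_sum [RHS]big_mkcond/=.
  by apply: eq_bigr => b _; rewrite indicE; case: (y \in _).
rewrite ler_nat.
have [->//|[b bs]] : s = [::] \/ exists b, b \in s.
  by case: (s) => [|b t]; [left|right; exists b; rewrite inE eqxx].
rewrite -(size_map fst s); apply: (H b.2 y).
- exact/C0/sF.
- rewrite all_map; apply/allP => b' b's /=; apply/mem_set/mball_sym.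
  rewrite (Cr _ _ (sF _ bs) (sF _ b's)).
  by move: b's; rewrite mem_filter => /andP[/set_mem].
- rewrite /separated_seq pairwise_map.
  have : uniq s by rewrite filter_uniq.
  rewrite uniq_pairwise; apply: (sub_in_pairwise (P := mem s)).
    move=> u v us vs /= uv; rewrite notin_setE.
    rewrite (Cr _ _ (sF _ bs) (sF _ us)).
    by have [] := Csep _ _ (sF _ us) (sF _ vs) (elimN eqP uv).
  exact/allP.
Qed.

(** * Separability up to a null set, and the ball relation *)

Definition ball_cover {R : realType} {X : pmetricType R} (e : R) (s : seq X) :
  set X := \bigcup_(x in [set` s]) mball OpenBalls x e.

Lemma open_ball_cover (R : realType) (X : pmetricType R) (e : R) (s : seq X) :
  open (ball_cover e s).
Proof. by apply: bigcup_open => x _; exact: open_mball. Qed.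

(** The traces on [U] of all [e]-balls cover [U]. Since [mu U] is finite, tau-additivity gives for
    each [i] a finite subfamily missing measure at most [1/(i+1)]; together these miss a null
    set. *)
Lemma tau_additive_ball_cover (R : realType) (X : pmetricType R)
  (mu : {measure set (borel X) -> \bar R}) (U : set X) (e : R) :
  tau_additive mu -> open U -> (mu U < +oo)%E -> 0 < e ->
  exists q : nat -> seq X, mu (U `\` \bigcup_i ball_cover e (q i)) = 0%E.
Proof.
move=> tau oU Ufin e0.
pose G : set (set X) := [set mball OpenBalls x e `&` U | x in [set: X]].
have GU : \bigcup_(O in G) O = U.
  apply/seteqP; split => [x [_ [z _ <-]] []//|x Ux].
  exists (mball OpenBalls x e `&` U); first by exists x.
  by split => //; exact: mball_center.
have oG : G `<=` open.
  by move=> _ [z _ <-]; apply: openI => //; exact: open_mball.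
have Ufn : mu U \is a fin_num by rewrite ge0_fin_numE.
have mU : measurable (U : set (borel X)) by exact: measurable_open.
have mcover s : measurable (ball_cover e s : set (borel X)).
  by apply: measurable_open; exact: open_ball_cover.
have approx i : exists s : seq X,
    (mu (U `\` ball_cover e s) <= (i.+1%:R^-1)%:E)%E.
  have := tau _ oG; rewrite GU => muU.
  have i0 : 0 < i.+1%:R^-1 :> R by rewrite invr_gt0.
  have := @ub_ereal_sup_adherent _ [set mu (\bigcup_(O in F) O)
    | F in [set F : set (set X) | finite_set F /\ F `<=` G]] _ i0.
  rewrite -muU => /(_ Ufn)[_ [F [/finite_seqP[l ->] lG] <-] lU].
  have /choice[c cl] : forall O : set X, exists x : X,
      O \in l -> O = mball OpenBalls x e `&` U.
    move=> O; have [Ol|Ol] := boolP (O \in l); last by exists point.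
    by have [x _ <-] := lG _ Ol; exists x.
  exists [seq c V | V <- l].
  have mW : measurable (U `&` ball_cover e [seq c V | V <- l] : set (borel X)).
    exact: measurableI.
  rewrite measureD// leeBlDr; last first.
    by rewrite ge0_fin_numE// (le_lt_trans _ Ufin)// le_measure ?inE.
  move: lU; rewrite lteBlDr// => /ltW lU; apply: (le_trans lU).
  rewrite addeC leeD2l// le_measure ?inE//.
    by apply: measurable_open; apply: bigcup_open => V /lG/oG.
  move=> x [V Vl Vx]; have := Vx; rewrite (cl _ Vl) => -[cOx Ux]; split => //.
  by exists (c V) => //=; rewrite map_f.
have [q qU] := choice approx.
exists q; apply/eqP; rewrite -measure_le0; apply/lee_addgt0Pr => d d0.
have [n /ltW nd] := ltr_add_invr d0; rewrite add0r in nd.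
rewrite add0e; apply: le_trans (le_trans (qU n) _); last by rewrite lee_fin.
rewrite le_measure ?inE//.
- by apply: measurableD => //; exact: bigcupT_measurable.
- exact: measurableD.
- by move=> x [Ux nx]; split => // nqx; apply: nx; exists n.
Qed.

(* tau-additivity gives a countable subcover up to a null set only when the union
   has finite measure, so the cover is built on each bounded ball separately. *)
Lemma tau_additive_separable (R : realType) (X : pmetricType R)
  (mu : {measure set (borel X) -> \bar R}) :
  tau_additive mu -> locally_finite mu ->
  exists (S : set X) (q : nat -> nat -> nat -> seq X),
    [/\ measurable (S : set (borel X)), mu (~` S) = 0%E &
       forall (x : X) (e : R), S x -> 0 < e ->
         exists n m i,
           ball_cover (n.+1%:R^-1 : R) (q n m i) x /\ n.+1%:R^-1 < e].
Proof.
move=> tau lf.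
pose U m := mball OpenBalls (point : X) m%:R.
have mU m : measurable (U m : set (borel X)) by exact: measurable_mball.
have /choice[q0 q0P] : forall p : nat * nat, exists q : nat -> seq X,
    mu (U p.2 `\` \bigcup_i ball_cover (p.1.+1%:R^-1 : R) (q i)) = 0%E.
  move=> [n m] /=; apply: tau_additive_ball_cover => //.
  - exact: open_mball.
  - by apply: lf => //; exact: mball_bounded.
pose q n m := q0 (n, m).
pose N n m := U m `\` \bigcup_i ball_cover (n.+1%:R^-1 : R) (q n m i).
have mN n m : measurable (N n m : set (borel X)).
  apply: measurableD => //; apply: bigcupT_measurable => i.
  by apply: measurable_open; exact: open_ball_cover.
(* [S] drops the null set missed at each scale [1/(n+1)] in each bounded piece [U m]; the pieces
   exhaust the space. *)
exists (~` \bigcup_n \bigcup_m N n m), q; split.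
- apply: measurableC; apply: bigcupT_measurable => n.
  exact: bigcupT_measurable.
- rewrite setCK; apply: measure_negligible.
    by apply: bigcupT_measurable => n; exact: bigcupT_measurable.
  apply: negligible_bigcup => n; apply: negligible_bigcup => m.
  by apply/negligibleP => //; exact: (q0P (n, m)).
- move=> x e Sx e0; have [n ne] := ltr_add_invr e0; rewrite add0r in ne.
  have [m xm] : exists m, U m x.
    exists (Num.truncn (mdist point x)).+1; rewrite /U/=; exact: truncnS_gt.
  have [i ix] : exists i, ball_cover n.+1%:R^-1 (q n m i) x.
    apply: contrapT => nx; apply: Sx; exists n => //; exists m => //.
    by split => // -[i _ ix]; apply: nx; exists i.
  by exists n, m, i.
Qed.

(** Inside [S * S], the open relation is a countable union of rectangles B(z,t) x B(z,s-t) with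
    [t = 1/(n+1)] and [z] a center of the covers; the closed one is the intersection of the open
    ones of radius [r + 1/(n+1)]. *)
Lemma measurable_ball_relation (R : realType) (X : pmetricType R)
  (S : set X) (q : nat -> nat -> nat -> seq X) (k : ball_kind) (r : R) :
  measurable (S : set (borel X)) ->
  (forall (x : X) (e : R), S x -> 0 < e -> exists n m i,
     ball_cover (n.+1%:R^-1 : R) (q n m i) x /\ n.+1%:R^-1 < e) ->
  measurable ([set p | (S p.1 /\ S p.2) /\ mball k p.1 r p.2]
              : set (borel X * borel X)).
Proof.
move=> mS Sq.
suff op s : measurable ([set p | (S p.1 /\ S p.2) /\ mball OpenBalls p.1 s p.2]
    : set (borel X * borel X)).
  case: k; first exact: op.
  rewrite [X in measurable X](_ : _ = \bigcap_n
    [set p | (S p.1 /\ S p.2) /\ mball OpenBalls p.1 (r + n.+1%:R^-1) p.2]).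
    by apply: bigcapT_measurable.
  apply/seteqP; split => -[x y] /=.
    move=> [Sxy xy] n _; split=> //=.
    by rewrite (le_lt_trans xy)// ltrDl invr_gt0.
  move=> xy; split; first by have [] := xy 0%N I.
  rewrite leNgt; apply/negP => /ltr_add_invr[n]; have [_ /= ] := xy n I.
  by move=> /lt_trans h /h; rewrite ltxx.
rewrite [X in measurable X](_ : _ = S `*` S `&` \bigcup_n \bigcup_m \bigcup_i
  \bigcup_(z in [set` q n m i])
    (mball OpenBalls z n.+1%:R^-1 `*` mball OpenBalls z (s - n.+1%:R^-1))).
  apply: measurableI; first exact: measurableX.
  do 3! [apply: bigcupT_measurable => ?].
  apply: fin_bigcup_measurable; first exact: finite_seq.
  by move=> z _; apply: measurableX; exact: measurable_mball.
apply/seteqP; split => -[x y] /= [[Sx Sy]].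
  move=> xy; split => //.
  (* Halving leaves room for two losses of [t = 1/(n+1)]: d(z,y) <= d(z,x) + d(x,y) < t + (s -
     2t). *)
  have [|n [m [i [[z zq zx] ns]]]] := Sq x ((s - mdist x y) / 2) Sx.
    by rewrite divr_gt0// subr_gt0.
  exists n => //; exists m => //; exists i => //; exists z => //; split => //=.
  have := metric_triangle z x y; move: zx ns => /=.
  by move: (mdist z x) (mdist z y) (mdist x y) n.+1%:R^-1 => a b c t; lra.
move=> [n _ [m _ [i _ [z zq [/= zx zy]]]]]; split => //.
have := metric_triangle x z y; rewrite (metric_sym x z); move: zx zy => /=.
by move: (mdist z x) (mdist z y) (mdist x y) n.+1%:R^-1 => a b c t; lra.
Qed.

(** * Greedy selection for functions of finite range *)

(** Induction on a list of values: its head is exceeded on [A] (recurse on the points above it), or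
    attained and maximal, or not a value on [A]. *)
Lemma finite_range_max (T : Type) (R : realType) (h : T -> R) (A : set T) :
  finite_set (range h) -> A !=set0 ->
  exists2 x1, A x1 & forall x, A x -> h x <= h x1.
Proof.
move=> /finite_seqP[e he] [x0 Ax0].
have : forall x, A x -> h x \in e.
  by move=> x _; suff : [set` e] (h x) by []; rewrite -he; exists x.
elim: e A x0 Ax0 {he} => [|v e IH] A x0 Ax0 hA; first by have := hA _ Ax0.
have [[y Ay vy]|vmax] := pselect (exists2 y, A y & v < h y).
  have [|x|x1 [Ax1 x1v] x1max] := IH (A `&` [set x | v < h x]) y.
  - by split.
  - move=> [/hA]; rewrite inE => /predU1P[hx|//] /=; by rewrite hx ltxx.
  exists x1 => // x Ax; have [vx|/le_trans->//] := ltP v (h x); last exact: ltW.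
  exact: x1max.
have {}vmax x : A x -> h x <= v.
  by move=> Ax; rewrite leNgt; apply/negP => vx; apply: vmax; exists x.
have [[y Ay yv]|nv] := pselect (exists2 y, A y & h y = v).
  by exists y => // x /vmax; rewrite yv.
apply: (IH A x0 Ax0) => x Ax; have := hA _ Ax; rewrite inE => /predU1P[hx|//].
by exfalso; apply: nv; exists x.
Qed.

(* Greedy selection: a point maximizing [h] on [A] contributes at most 1 on its
   own [B x], and every separated sequence of the rest extends by that point. *)
Lemma greedy_bound d (T : measurableType d) (R : realType)
  (mu : {measure set T -> \bar R}) (B : T -> set T) (h : T -> R)
  (n : nat) (A : set T) :
  measurable_fun setT h -> (forall x, 0 <= h x) -> finite_set (range h) ->
  measurable A -> (forall x, measurable (B x)) ->
  (forall x, A x -> ((h x)%:E * mu (B x) <= 1)%E) ->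
  (forall s, all (fun x => x \in A) s ->
     separated_seq B s -> (size s <= n)%N) ->
  (\int[mu]_(x in A) (h x)%:E <= n%:R%:E)%E.
Proof.
move=> mh h0 fh + mB; elim: n A => [|n IH] A mA hB sA.
  (* For [n = 0], a point of [A] would be a separated sequence of length 1. *)
  have -> : A = set0.
    rewrite -subset0 => x Ax; have := sA [:: x].
    by rewrite /= andbT; move/(_ (mem_set Ax) isT).
  by rewrite integral_set0.
have [->|/set0P A0] := eqVneq A set0.
  by rewrite integral_set0 lee_fin.
have [x1 Ax1 x1max] := finite_range_max fh A0.
have mhE (D : set T) :
    measurable D -> measurable_fun D (EFin \o h : T -> \bar R).
  by move=> mD; apply/measurable_EFinP; exact: measurable_funS mh.
have mAB : measurable (A `&` B x1) by exact: measurableI.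
have mAD : measurable (A `\` B x1) by exact: measurableD.
rewrite -(setUIDK A (B x1)) ge0_integral_setU//; last 3 first.
- by apply: mhE; exact: measurableU.
- by move=> x _; rewrite lee_fin.
- by apply/disj_setPS => x [[_ Bx] [_ /(_ Bx)]].
rewrite -natr1 EFinD addeC; apply: leeD; last first.
  apply: (@le_trans _ _ ((h x1)%:E * mu (B x1))%E); last exact: hB.
  apply: (@le_trans _ _ (\int[mu]_(x in A `&` B x1) (h x1)%:E)%E).
    apply: ge0_le_integral => //.
    - by move=> x _; rewrite lee_fin.
    - exact: mhE.
    - by move=> x [/x1max]; rewrite lee_fin.
  rewrite integral_cst// lee_wpmul2l ?lee_fin//.
  by rewrite le_measure ?inE.
apply: IH => //.
- by move=> x [Ax _]; exact: hB.
- move=> s sA' ss; rewrite -ltnS; apply: (sA (x1 :: s)) => /=.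
    rewrite mem_set//=; apply: sub_all sA' => x.
    by rewrite !inE => -[].
  rewrite /separated_seq/= -/(separated_seq B s) ss andbT.
  by apply: sub_all sA' => x; rewrite inE notin_setE => -[].
Qed.

(** * Comparison of integrals *)

Import HBNNSimple.

(* The integral of a nonnegative function is a supremum over the simple functions
   below it, so it is monotone even without measurability. *)
Lemma le_integral_nonmeasurable d (T : measurableType d) (R : realType)
  (mu : {measure set T -> \bar R}) (f g : T -> \bar R) :
  (forall x, 0 <= f x)%E -> (forall x, f x <= g x)%E ->
  (\int[mu]_x f x <= \int[mu]_x g x)%E.
Proof.
move=> f0 fg; have g0 x : (0 <= g x)%E by exact: le_trans (fg x).
rewrite !ge0_integralTE//; apply: le_ereal_sup => _ [h hf <-].
by exists h => // x; exact: le_trans (fg x).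
Qed.

(** The almost everywhere comparison is applied to each simple function below [f], which is
    measurable even when [f] is not known to be. *)
Lemma le_integral_conull d (T : measurableType d) (R : realType)
  (mu : {measure set T -> \bar R}) (N : set T) (f g : T -> \bar R) :
  measurable N -> mu N = 0%E -> measurable_fun setT g ->
  (forall x, 0 <= f x)%E -> (forall x, 0 <= g x)%E ->
  (forall x, ~ N x -> (f x <= g x)%E) ->
  (\int[mu]_x f x <= \int[mu]_x g x)%E.
Proof.
move=> mN N0 mg f0 g0 fg; rewrite ge0_integralTE//.
apply: ge_ereal_sup => _ [h hf <-].
rewrite -integralT_nnsfun; apply: ae_ge0_le_integral => //.
- by move=> x _; rewrite lee_fin.
- exact/measurable_EFinP.
- exists N; split => // x /= /not_implyP[_ hg]; apply: contrapT => /fg fgx.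
  by apply: hg; exact: le_trans (hf x) fgx.
Qed.

(** * The kernel estimate and Tonelli's theorem *)

(** The kernel may have no maximum, but a simple function below it does, and vanishes off
    [ysection D y]; [greedy_bound] applies to each such function. *)
Lemma kernel_bound d (T : measurableType d) (R : realType)
  (mu : {measure set T -> \bar R}) (D : set (T * T)) (n : nat) (y : T) :
  measurable D -> (forall x, mu (xsection D x) < +oo)%E ->
  (forall s, all (fun x => x \in ysection D y) s ->
     separated_seq (xsection D) s -> (size s <= n)%N) ->
  (\int[mu]_x ((fine (mu (xsection D x)))^-1 * \1_D (x, y))%:E
    <= n%:R%:E)%E.
Proof.
move=> mD Dfin sD.
have u0 x : 0 <= (fine (mu (xsection D x)))^-1 by rewrite invr_ge0 fine_ge0.
rewrite ge0_integralTE => [|x]; last by rewrite lee_fin mulr_ge0// indicE.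
apply: ge_ereal_sup => _ [h hf <-].
rewrite -integralT_nnsfun.
have -> : (\int[mu]_x (h x)%:E = \int[mu]_(x in ysection D y) (h x)%:E)%E.
  rewrite [RHS]integral_mkcond; apply: eq_integral => x _; rewrite patchE.
  case: ifPn => // xD; apply/eqP; rewrite eq_le !lee_fin fun_ge0 andbT.
  rewrite -lee_fin (le_trans (hf x))// indicE.
  suff /negbTE -> : (x, y) \notin D by rewrite mulr0.
  by apply: contra xD; rewrite mem_ysection.
apply: (greedy_bound (B := xsection D)) => //.
- exact: measurable_ysection.
- by move=> x; exact: measurable_xsection.
- move=> x _.
  have mfin : mu (xsection D x) \is a fin_num by rewrite ge0_fin_numE.
  rewrite -(fineK mfin) -EFinM lee_fin.
  apply: (@le_trans _ _
    ((fine (mu (xsection D x)))^-1 * fine (mu (xsection D x)))).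
    rewrite ler_wpM2r ?fine_ge0//.
    have := hf x; rewrite lee_fin => /le_trans-> //.
    by rewrite ler_piMr// indicE lern1 leq_b1.
  (* A null section is harmless: the product is then 0. *)
  have [->|m0] := eqVneq (fine (mu (xsection D x))) 0; first by rewrite mulr0.
  by rewrite mulVf.
Qed.

(** [G] is a partial integral of [F]; exchanging the order leaves, for each [y], [g y] times the
    integral bounded by [kernel_bound]. *)
Lemma le_integral_averages d (T : measurableType d) (R : realType)
  (mu : {sigma_finite_measure set T -> \bar R}) (D : set (T * T)) (n : nat)
  (g : T -> \bar R) :
  measurable D -> (forall x, mu (xsection D x) < +oo)%E ->
  (forall y s, all (fun x => x \in ysection D y) s ->
     separated_seq (xsection D) s -> (size s <= n)%N) ->
  measurable_fun setT g -> (forall x, 0 <= g x)%E ->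
  let G x := (((fine (mu (xsection D x)))^-1)%:E *
               \int[mu]_(y in xsection D x) g y)%E in
  measurable_fun setT G /\ (\int[mu]_x G x <= n%:R%:E * \int[mu]_x g x)%E.
Proof.
move=> mD Dfin sD mg g0 G.
pose u x := (fine (mu (xsection D x)))^-1.
pose F (p : T * T) : \bar R := ((u p.1 * \1_D p)%:E * g p.2)%E.
have u0 x : 0 <= u x by rewrite invr_ge0 fine_ge0.
have um : measurable_fun setT u.
  (* The inverse is written as a real power, which is measurable on the whole line and agrees with
     it on nonnegative reals, 0 included. *)
  rewrite (_ : u = (@powR R)^~ (-1) \o fine \o (fun x => mu (xsection D x))).
    apply: measurableT_comp (measurable_fun_xsection mu mD).
    exact: measurableT_comp (measurable_powR _) (fine_measurable measurableT).
  by apply/funext => x /=; rewrite powR_inv1// fine_ge0.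
have mF : measurable_fun setT F.
  apply: emeasurable_funM.
    apply/measurable_EFinP; apply: measurable_funM.
      exact: measurableT_comp um measurable_fst.
    exact: measurable_indic.
  exact: measurableT_comp mg measurable_snd.
have F0 p : (0 <= F p)%E.
  by apply: mule_ge0 => //; rewrite lee_fin mulr_ge0// indicE.
have GF x : G x = (\int[mu]_y F (x, y))%E.
  rewrite /G -ge0_integralZl//; last 3 first.
  - exact: measurable_xsection.
  - exact: measurable_funS mg.
  - by rewrite lee_fin; exact: u0.
  rewrite integral_mkcond; apply: eq_integral => y _.
  rewrite patchE mem_xsection /F/= indicE.
  by case: ifPn => _; rewrite ?mulr1// mulr0 mul0e.
split.
  rewrite (_ : G = fun x => (\int[mu]_y F (x, y))%E); last exact/funext.
  exact: measurable_fun_fubini_tonelli_F.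
under eq_integral do rewrite GF.
rewrite fubini_tonelli// -ge0_integralZl// ?lee_fin//.
apply: ge0_le_integral => //.
- by move=> y _; exact: integral_ge0.
- exact: measurable_fun_fubini_tonelli_G.
- exact: emeasurable_funM.
- move=> y _; rewrite /F/=.
  rewrite ge0_integralZr//.
  - by apply: lee_wpmul2r => //; apply: kernel_bound => //; exact: sD.
  - apply/measurable_EFinP; apply: measurable_funM => //.
    exact: measurableT_comp (measurable_indic _) (measurable_pair2 _).
  - by move=> x _; rewrite lee_fin mulr_ge0// indicE.
Qed.

(** * The averaging bound for tau-additive, locally finite measures *)

Lemma locally_finite_sigma_finite (R : realType) (X : pmetricType R)
  (mu : {measure set (borel X) -> \bar R}) :
  locally_finite mu -> sigma_finite [set: borel X] mu.
Proof.
move=> lf; exists (fun n => mball OpenBalls (point : X) n%:R).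
  apply/esym; rewrite -subTset => x _.
  by exists (Num.truncn (mdist point x)).+1 => //; exact: truncnS_gt.
move=> n; have mB := measurable_mball OpenBalls (point : X) n%:R.
by split=> //; apply: lf => //; exact: mball_bounded.
Qed.

(** Tonelli's theorem takes a bundled sigma-finite measure; this turns the proposition into the
    bundle. *)
Lemma sigma_finite_measure_pack d (T : measurableType d) (R : realType)
  (mu : {measure set T -> \bar R}) :
  sigma_finite setT mu ->
  exists nu : {sigma_finite_measure set T -> \bar R}, mu = nu.
Proof.
move=> sf.
pose sfinite := isSFinite.Build _ _ _ (Measure.sort mu)
  (sfinite_measure_sigma_finite sf).
pose sigmafinite := isSigmaFinite.Build _ _ _ (Measure.sort mu) sf.
exists (HB.pack_for (SigmaFiniteMeasure.type T R) (Measure.sort mu)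
  sfinite sigmafinite).
exact: eq_measure.
Qed.

(** The balls are cut down to the conull set [S], where their relation [D] is product measurable;
    for centers in [S] this changes neither masses nor integrals. *)
Lemma averaging_L1_norm_le (R : realType) (X : pmetricType R) (k : ball_kind)
  (r : R) (n : nat) (mu : {measure set (borel X) -> \bar R}) :
  (forall (y : X) (s : seq X), all (fun x => x \in mball k y r) s ->
     separated_seq (mball k ^~ r) s -> (size s <= n)%N) ->
  tau_additive mu -> locally_finite mu ->
  (averaging_L1_norm mu k r <= n%:R%:E)%E.
Proof.
move=> sepn tau lf.
have [S [q [mS S0 Sq]]] := tau_additive_separable tau lf.
have [nu munu] :=
  sigma_finite_measure_pack (locally_finite_sigma_finite lf).
subst mu.
pose D := [set p : X * X | (S p.1 /\ S p.2) /\ mball k p.1 r p.2].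
have mD : measurable (D : set (borel X * borel X)).
  exact: measurable_ball_relation mS Sq.
have DE x : xsection D x `<=` mball k x r.
  by move=> y; rewrite /xsection/= inE => -[].
have Bfin x : (nu (mball k x r) < +oo)%E.
  by apply: lf; [exact: measurable_mball|exact: mball_bounded].
have DS x : S x -> xsection D x = mball k x r `&` S.
  move=> Sx; apply/seteqP; split => y; rewrite /xsection/= inE.
    by move=> [[_ Sy] xy].
  by move=> [].
have Dfin x : (nu (xsection D x) < +oo)%E.
  apply: le_lt_trans (Bfin x); rewrite le_measure ?inE//.
    exact: (@measurable_xsection _ _ (borel X) (borel X)).
  exact: measurable_mball.
(* Entries of [s] lie in [S], so avoiding a section of [D] amounts to avoiding the whole ball. *)
have Dsep y s : all (fun x => x \in ysection D y) s ->
    separated_seq (xsection D) s -> (size s <= n)%N.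
  move=> sy ss; apply: (sepn y).
    by apply: sub_all sy => x; rewrite !inE /ysection/= inE => -[_] /mball_sym.
  move: ss; apply: sub_in_pairwise sy => u v.
  rewrite !inE /ysection/= !inE => -[[Su _] _] [[Sv _] _] /=.
  by rewrite DS// !notin_setE; apply: contra_not.
have mB x : measurable (mball k x r : set (borel X)).
  exact: measurable_mball.
have mNS : measurable (~` S : set (borel X)) by exact: measurableC.
have DxE x : S x -> xsection D x = mball k x r `\` ~` S.
  by move=> Sx; rewrite DS// setDE setCK.
have muDS x : S x -> nu (xsection D x) = nu (mball k x r).
  move=> Sx; rewrite DxE// measureD//; last exact: Bfin.
  rewrite [X in (_ - X)%E](_ : _ = 0%E) ?sube0//.
  by apply: (@subset_measure0 _ _ _ nu _ (~` S)) => //; exact: measurableI.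
apply: ereal_inf_lbound; exists n%:R => //; split=> // g ig.
rewrite !Lnorm1.
have [mg gfin] := integrableP _ _ _ ig.
have mabs : measurable_fun setT (fun x => `|(g x)%:E|)%E.
  exact: measurableT_comp.
have [mG /le_trans Gle] := le_integral_averages
  mD Dfin Dsep mabs (fun=> abse_ge0 _).
apply: le_trans (Gle _ (lexx _)).
apply: (@le_integral_conull _ _ _ nu (~` S)) => //.
- move=> x; apply: mule_ge0; last exact: integral_ge0.
  by rewrite lee_fin invr_ge0 fine_ge0.
move=> x /contrapT Sx /=; rewrite muDS//.
have igB : nu.-integrable (mball k x r : set (borel X)) (EFin \o g).
  exact: integrableS ig.
have mgB : measurable_fun (mball k x r : set (borel X)) (EFin \o g).
  exact: measurable_funS mg.
have -> : (\int[nu]_(y in xsection D x) `|(g y)%:E| =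
    \int[nu]_(y in mball k x r) `|(g y)%:E|)%E.
  rewrite DxE//; apply/esym/ge0_negligible_integral => //.
  exact: measurableT_comp mgB.
(* Off the support the average is 0 by convention, and the bound is trivial. *)
rewrite /averaging; case: ifPn => _; last first.
  rewrite normr0; apply: mule_ge0; last exact: integral_ge0.
  by rewrite lee_fin invr_ge0 fine_ge0.
rewrite normrM EFinM ger0_norm ?invr_ge0 ?fine_ge0//.
apply: lee_wpmul2l; first by rewrite lee_fin invr_ge0 fine_ge0.
rewrite -abse_EFin fineK; last exact: integrable_fin_num.
exact: le_abse_integral.
Qed.

(** * Finite weighted sums of Dirac measures *)

Lemma weighted_dirac_sumE (R : realType) (X : pmetricType R) (N : nat)
  (x : nat -> X) (c : nat -> {posnum R}) (A : set X) :
  weighted_dirac_sum N x c A = (\sum_(i < N) (c i)%:num * \1_A (x i))%:E.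
Proof.
rewrite /weighted_dirac_sum/= /msum -sumEFin; apply: eq_bigr => i _.
by rewrite /= /mscale/= diracE indicE EFinM.
Qed.

Lemma weighted_dirac_sum_locally_finite (R : realType) (X : pmetricType R)
  (N : nat) (x : nat -> X) (c : nat -> {posnum R}) :
  locally_finite (weighted_dirac_sum N x c).
Proof. by move=> A _ _; rewrite weighted_dirac_sumE ltry. Qed.

Lemma weighted_dirac_sum_neq0 (R : realType) (X : pmetricType R)
  (N : nat) (x : nat -> X) (c : nat -> {posnum R}) : (1 <= N)%N ->
  weighted_dirac_sum N x c [set: X] <> 0%E.
Proof.
case: N => // N _; rewrite weighted_dirac_sumE big_ord_recl => -[].
apply/eqP; rewrite gt_eqF//; apply: ltr_wpDr.
  by apply: sumr_ge0 => i _; rewrite mulr_ge0// indicE.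
by rewrite indicT mulr1.
Qed.

(** One member of [G] through each atom lying in the union gives a finite subfamily that already
    carries the full mass. *)
Lemma weighted_dirac_sum_tau_additive (R : realType) (X : pmetricType R)
  (N : nat) (x : nat -> X) (c : nat -> {posnum R}) :
  tau_additive (weighted_dirac_sum N x c).
Proof.
move=> G oG; apply/eqP; rewrite eq_le; apply/andP; split; last first.
  apply: ge_ereal_sup => _ [F [_ FG] <-]; rewrite le_measure ?inE//.
  - by apply: measurable_open; apply: bigcup_open => V /FG/oG.
  - by apply: measurable_open; apply: bigcup_open => V /oG.
  - exact: bigcup_subset.
have /choice[V VG] : forall i : nat, exists V : set X,
    (\bigcup_(O in G) O) (x i) -> G V /\ V (x i).
  move=> i; have [[V GV Vx]|nx] := pselect ((\bigcup_(O in G) O) (x i)).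
    by exists V.
  by exists set0 => /nx.
pose F := [set V i | i in `I_N `&` [set i | (\bigcup_(O in G) O) (x i)]].
apply: (@le_trans _ _ (weighted_dirac_sum N x c (\bigcup_(O in F) O))).
  rewrite !weighted_dirac_sumE lee_fin; apply: ler_sum => i _.
  rewrite ler_wpM2l// !indicE ler_nat.
  have [/set_mem Ux|//] := boolP (x i \in \bigcup_(O in G) O).
  rewrite mem_set//; exists (V i); last exact: (VG i Ux).2.
  by exists i => //; split => //=; exact: ltn_ord.
apply: ereal_sup_ubound; exists F => //; split.
  apply: finite_image; apply: sub_finite_set (finite_II N); exact: subIsetl.
by move=> _ [i [_ Ui] <-]; exact: (VG i Ui).1.
Qed.

(** * The lower bound from a separated sequence *)

Lemma separated_seq_count (R : realType) (X : pmetricType R) (k : ball_kind)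
  (r : R) (s : seq X) (x : X) : 0 < r -> separated_seq (mball k ^~ r) s ->
  x \in s -> count (fun z => z \in mball k x r) s = 1%N.
Proof.
move=> r0 + xs; move: xs; elim: s => // z s IH; rewrite inE /separated_seq/=.
rewrite -/(separated_seq (mball k ^~ r) s) => xzs /andP[/allP zs ss].
have nball (u v : X) : u \notin mball k v r -> v \notin mball k u r.
  by rewrite !notin_setE; apply: contra_not; exact: mball_sym.
case/predU1P: xzs => [->|xs].
  rewrite mem_set; last exact: mball_center.
  rewrite (_ : count _ s = 0%N)//; apply/eqP; rewrite -leqn0 leqNgt -has_count.
  by apply/hasPn => u /zs.
by rewrite (negbTE (nball _ _ (zs _ xs))) IH.
Qed.

(** With weight [w] at [y] and 1 at each of the [n] entries, the indicator of [y] has norm [w] and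
    average [w/(1+w)] at every entry, so the ratio is at least [n/(1+w)]. The choice [w = 1/n] makes
    this exceed [n - 1 >= E]. *)
Lemma averaging_L1_norm_lower_bound (R : realType) (X : pmetricType R)
  (k : ball_kind) (r : R) (y : X) (s : seq X) (E : nat) :
  0 < r -> all (fun x => x \in mball k y r) s ->
  separated_seq (mball k ^~ r) s -> (1 <= E < size s)%N ->
  exists c : nat -> {posnum R},
  (E%:R%:E < averaging_L1_norm
     (weighted_dirac_sum (size s).+1 (nth y (y :: s)) c) k r)%E.
Proof.
move=> r0 sy sep /andP[E1 sE].
pose n := size s.
have n0 : 0 < n%:R^-1 :> R by rewrite invr_gt0 ltr0n (leq_ltn_trans _ sE).
have N0 : 0 < n%:R :> R by rewrite -invr_gt0.
pose c i : {posnum R} := if i is 0%N then PosNum n0 else PosNum ltr01.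
exists c.
set mu := weighted_dirac_sum _ _ _.
have muE (A : set X) :
    mu A = (n%:R^-1 * \1_A y + (count (fun x => x \in A) s)%:R)%:E.
  rewrite weighted_dirac_sumE big_ord_recl/=; congr (_ + _)%:E.
  rewrite (eq_bigr (fun i : 'I_(size s) => (nth y s i \in A)%:R)); last first.
    by move=> i _; rewrite /= mul1r indicE.
  rewrite -sum1_count natr_sum [RHS]big_mkcond [RHS](big_nth y) big_mkord.
  by apply: eq_bigr => i _; case: (_ \in A).
(* As an entry, [y] would have only itself in its ball, which contains all of [s]; but
   [size s > E >= 1]. *)
have ys : y \notin s.
  apply/negP => /(separated_seq_count r0 sep).
  by move: sy; rewrite all_count => /eqP -> s1; move: sE; rewrite s1; lia.
have muB x : x \in s -> mu (mball k x r) = (n%:R^-1 + 1)%:E.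
  move=> xs; rewrite muE (separated_seq_count r0 sep xs) indicE.
  by rewrite mem_set ?mulr1//; apply: mball_sym; exact/set_mem/(allP sy).
have county A : count (fun x => x \in [set y] `&` A) s = 0%N.
  apply/eqP; rewrite -leqn0 leqNgt -has_count; apply/hasPn => x xs.
  by rewrite notin_setE/= => -[xy _]; move: ys; rewrite -xy xs.
(* Atoms lie in the support, so the junk value of [averaging] does not occur at them. *)
have suppx x : x \in s -> msupport mu x.
  move=> xs [[b t] /= [t0 bt0] bx].
  suff /gt_eqF/eqP/(_ bt0) : (0 < mu (mball OpenBalls b t))%E by [].
    rewrite muE lte_fin ltr_wpDl ?mulr_ge0// ltr0n -has_count.
    by apply/hasP; exists x => //; exact/mem_set.
pose g : X -> R := \1_[set y].
have my := measurable_point y.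
have avg x : x \in s -> averaging mu k r g x = (n%:R + 1)^-1.
  move=> xs; rewrite /averaging mem_set; last exact: suppx.
  rewrite muB// /Rintegral integral_indic//; last exact: measurable_mball.
  rewrite muE county addr0 indicE mem_set ?mulr1/=; last first.
    by split => //; apply: mball_sym; exact/set_mem/(allP sy).
  by rewrite -invfM mulrDl mulVf ?mul1r 1?addrC// gt_eqF.
have Ng : ('N[mu]_1 [EFin \o g] = (n%:R^-1)%:E)%E.
  rewrite Lnorm1 (eq_integral (fun x : borel X => (\1_[set y] x)%:E)).
    rewrite integral_indic// muE county addr0 indicE mem_set ?mulr1//.
  by move=> x _; rewrite gee0_abs// lee_fin /g indicE.
have ig : mu.-integrable [set: borel X] (EFin \o g).
  apply/integrableP; split; first exact/measurable_EFinP/measurable_indic.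
  by rewrite -Lnorm1 Ng ltry.
(* Only the mass on the entries of [s] is kept: [n] unit atoms with average [1/(n+1)] each. *)
have Na : ((n%:R / (n%:R + 1))%:E <= 'N[mu]_1 [EFin \o averaging mu k r g])%E.
  have ms : measurable ([set` s] : set (borel X)).
    apply: countable_measurable; first exact: measurable_point.
    exact/finite_set_countable/finite_seq.
  rewrite Lnorm1 mulrC EFinM.
  have -> : n%:R%:E = mu [set` s] :> \bar R.
    rewrite muE indicE memNset ?mulr0 ?add0r; last exact/negP.
    rewrite (eq_in_count (a2 := predT)) ?count_predT// => x xs.
    by rewrite mem_set.
  rewrite -[X in mu X]setIT -(integral_indic mu measurableT ms).
  rewrite -ge0_integralZl//; last exact/measurable_EFinP/measurable_indic.
  apply: le_integral_nonmeasurable => x.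
    by rewrite -EFinM lee_fin mulr_ge0 ?invr_ge0 ?addr_ge0 ?indicE.
  rewrite indicE; have [/set_mem/avg/= ->|_] := boolP (x \in _).
    by rewrite mule1 ger0_norm ?invr_ge0 ?addr_ge0.
  by rewrite mule0.
have En : E%:R + 1 <= n%:R :> R by rewrite natr1 ler_nat.
have E0 : 0 <= E%:R :> R by [].
rewrite ltNge; apply/negP => nE.
(* A norm at most [E] would yield an admissible constant [K < n^2/(n+1)], since [E(n+1) <= n^2 - 1];
   testing [K] on [g] refutes it. *)
have /ereal_inf_lt[_ [K [K0 HK] <-]] : (averaging_L1_norm mu k r <
    (n%:R * n%:R / (n%:R + 1))%:E)%E.
  apply: le_lt_trans nE _; rewrite lte_fin ltr_pdivlMr ?ltr_wpDr//.
  by nra.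
rewrite lte_fin ltNge => /negP; apply.
have := le_trans Na (HK _ ig); rewrite Ng lee_fin.
by rewrite ler_pdivlMr// mulrAC.
Qed.

(** * The cycle of implications *)

Theorem theorem2p10 (R : realType) (X : pmetricType R)
  (X_two_points : exists x y : X, x <> y)
  (E : nat) (E_ge1 : (1 <= E)%N) (k : ball_kind) :
  [<-> (besicovitch_constant X k <= E%:R%:E)%E;
       forall (r : R) (mu : {measure set (borel X) -> \bar R}),
         0 < r -> mu [set: borel X] <> 0%E ->
         tau_additive mu -> locally_finite mu ->
         (averaging_L1_norm mu k r <= E%:R%:E)%E;
       forall (r : R) (N : nat) (x : nat -> X) (c : nat -> {posnum R}),
         0 < r -> (1 <= N)%N ->
         (averaging_L1_norm (weighted_dirac_sum N x c) k r <= E%:R%:E)%E].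
Proof.
tfae.
- move=> /besicovitch_constantP H r mu r0 _; apply: averaging_L1_norm_le => y s.
  exact: H.
- move=> H r N x c r0 N1; apply: H => //.
  + exact: weighted_dirac_sum_neq0.
  + exact: weighted_dirac_sum_tau_additive.
  + exact: weighted_dirac_sum_locally_finite.
- move=> H; apply/besicovitch_constantP => r y s r0 sy ss.
  rewrite leqNgt; apply/negP => sE.
  have [|c] := averaging_L1_norm_lower_bound (E := E) r0 sy ss.
    by rewrite E_ge1.
  by rewrite ltNge H.
Qed.
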